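(* Let $p,n\in\mathbb{N}$ with $p\ge1$ even, $n\ge p+\frac p2$, and $r\in\mathbb{N}$ with $r\le p$. Then $$\overline{X}^{p,r,0}=n^{2r-1}\big(T_n^{\bm\alpha}-H_n^{\bm\alpha,1}\big),$$ where $\alpha_k=(-1)^r\mathcal{N}_{2p+1}^{(2r)}(p+1-k)$, $k=0,\dots,p$.
   Context: Cardinal B-spline: $\mathcal{N}_0(t)=1$ for $t\in[0,1)$, $0$ otherwise; $\mathcal{N}_p(t)=\frac{t}{p}\mathcal{N}_{p-1}(t)+\frac{p+1-t}{p}\mathcal{N}_{p-1}(t-1)$, $p\ge1$ (support $[0,p+1]$, $C^{p-1}$). Reduced-space basis ($p$ even): with $C_c(x)=\mathcal{N}_p\big(nx-c+\tfrac{p+1}{2}\big)$, for $i=1,\dots,n$, $x\in[0,1]$, $$\overline{N}^p_{i,0}(x)=\sum_{m\in\mathbb{Z}}\Big(C_{i-\frac12+2mn}(x)-C_{-(i-\frac12)+2mn}(x)\Big).$$ These form a basis of the $C^{p-1}$ splines of degree $p$ with breakpoints $k/n$ whose derivatives of all even orders $\le p-1$ vanish at $0$ and $1$. $\overline{X}^{p,r,0}_{i,j}=\int_0^1(\overline{N}^p_{i,0})^{(r)}(\overline{N}^p_{j,0})^{(r)}\,\mathrm{d}x$ (piecewise derivatives if $r=p$). With $\alpha_k=0$ for $k>p$: $(T_n^{\bm\alpha})_{i,j}=\alpha_{|i-j|}$ and $(H_n^{\bm\alpha,1})_{i,j}=\alpha_{i+j-1}+\alpha_{2n+1-i-j}$.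 *)

(* Defs.v *)
From Stdlib Require Import Reals Lra Lia ZArith.
From Coquelicot Require Import Coquelicot.
Open Scope R_scope.

Fixpoint cardN (p : nat) (t : R) : R :=
  match p with
  | O => if Rle_dec 0 t then (if Rlt_dec t 1 then 1 else 0) else 0
  | S q => t / INR (S q) * cardN q t
           + (INR (S q) + 1 - t) / INR (S q) * cardN q (t - 1)
  end.

(* Sum over m in Z of f m (absolutely; here only finitely many nonzero terms). *)
Definition zsum (f : Z -> R) : R :=
  Series (fun k : nat => f (Z.of_nat k))
  + Series (fun k : nat => f (- Z.of_nat (S k))%Z).

Definition Cc (p n : nat) (c : R) (x : R) : R :=
  cardN p (INR n * x - c + (INR p + 1) / 2).

Definition Nbar (p n i : nat) (x : R) : R :=
  zsum (fun m : Z =>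
    Cc p n (INR i - /2 + 2 * IZR m * INR n) x
    - Cc p n (- (INR i - /2) + 2 * IZR m * INR n) x).

(* \overline{X}^{p,r,0}_{i,j}: integral over [0,1] of products of r-th
   derivatives (Coquelicot's Derive_n; for r = p these agree with the
   piecewise derivatives except at finitely many breakpoints). *)
Definition Xbar (p r n i j : nat) : R :=
  RInt (fun x => Derive_n (Nbar p n i) r x * Derive_n (Nbar p n j) r x) 0 1.

Definition alpha (p r k : nat) : R :=
  if (k <=? p)%nat
  then (-1) ^ r * Derive_n (cardN (2 * p + 1)) (2 * r) (INR (p + 1 - k))
  else 0.

(* Toeplitz and Hankel entries (1-based indices). *)
Definition toeplitzT (a : nat -> R) (i j : nat) : R :=
  a (if (j <=? i)%nat then (i - j)%nat else (j - i)%nat).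
Definition hankelH1 (a : nat -> R) (n i j : nat) : R :=
  a (i + j - 1)%nat + a (2 * n + 1 - i - j)%nat.

(* Main.v *)
Require Import Defs.
From Stdlib Require Import Reals ZArith Lra Lia.
From Coquelicot Require Import Coquelicot.
Open Scope R_scope.

(** On (0,1) only three terms of [Nbar] survive: the spline centred at i - 1/2
    and its mirror images at 0 and n (in the variable n x), taken with sign -1.
    Reflecting at 0 and n glues the products of these terms into integrals over
    the whole support, i.e. correlations of two integer shifts of the r-th
    derivative of [cardN p].  That derivative is the r-th backward difference
    of [cardN (p - r)] and is even or odd about (p + 1) / 2, so each correlation
    is a convolution of backward differences.  Integration by parts moves one
    unit of degree between the factors of [conv (cardN a) (cardN b)], which is
    therefore [cardN (a + b + 1)], and differences pass through [conv].

    For r = p the derivatives exist only off the breakpoints.  As p is even, the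
    breakpoints k / n become integers after scaling by n, so all integrals are
    taken over integer intervals and identities are needed at non-integers only. *)

(** * Points off the integers *)

Definition nonint (t : R) : Prop := exists k : Z, IZR k < t < IZR k + 1.

Lemma nonint_plus_IZR (t : R) (m : Z) : nonint t -> nonint (t + IZR m).
Proof. intros [k Hk]. exists (k + m)%Z. rewrite plus_IZR. lra. Qed.

Lemma nonint_IZR_minus (t : R) (m : Z) : nonint t -> nonint (IZR m - t).
Proof. intros [k Hk]. exists (m - k - 1)%Z. rewrite !minus_IZR. lra. Qed.

Lemma nonint_minus1 (t : R) : nonint t -> nonint (t - 1).
Proof. exact (nonint_plus_IZR t (-1)). Qed.

Lemma integer_or_nonint (t : R) : nonint t \/ exists k : Z, t = IZR k.
Proof.
  destruct (archimed t) as [H1 H2].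
  destruct (Req_dec t (IZR (up t) - 1)) as [E | E].
  - right. exists (up t - 1)%Z. rewrite minus_IZR. exact E.
  - left. exists (up t - 1)%Z. rewrite minus_IZR. lra.
Qed.

(** * Integration on the integer mesh *)

(** The witness [g] is continuous on the whole line and may differ from cell to cell, so [f] has
    one-sided limits at the integers while its values there are left free. This suffices for
    integrability between integers and survives products, shifts and reflections. *)
Definition pwc (f : R -> R) : Prop :=
  forall k : Z, exists g : R -> R,
    (forall x, continuous g x) /\
    (forall x, IZR k < x < IZR k + 1 -> f x = g x).

Lemma pwc_continuous (f : R -> R) : (forall x, continuous f x) -> pwc f.
Proof. intros H k. exists f. auto. Qed.

Lemma pwc_plus (f g : R -> R) : pwc f -> pwc g -> pwc (fun t => f t + g t).
Proof.
  intros Hf Hg k. destruct (Hf k) as [f' [Cf Ef]], (Hg k) as [g' [Cg Eg]].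
  exists (fun t => f' t + g' t). split.
  - intro x. apply (continuous_plus f' g'); auto.
  - intros x Hx. now rewrite Ef, Eg.
Qed.

Lemma pwc_mult (f g : R -> R) : pwc f -> pwc g -> pwc (fun t => f t * g t).
Proof.
  intros Hf Hg k. destruct (Hf k) as [f' [Cf Ef]], (Hg k) as [g' [Cg Eg]].
  exists (fun t => f' t * g' t). split.
  - intro x. apply (continuous_mult f' g'); auto.
  - intros x Hx. now rewrite Ef, Eg.
Qed.

Lemma pwc_scal (c : R) (f : R -> R) : pwc f -> pwc (fun t => c * f t).
Proof. apply (pwc_mult (fun _ => c)). apply pwc_continuous. intro; apply continuous_const. Qed.

Lemma pwc_ext (f g : R -> R) :
  (forall t, nonint t -> f t = g t) -> pwc f -> pwc g.
Proof.
  intros E Hf k. destruct (Hf k) as [f' [Cf Ef]]. exists f'. split; auto.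
  intros x Hx. rewrite <- E; auto. now exists k.
Qed.

Lemma pwc_minus (f g : R -> R) : pwc f -> pwc g -> pwc (fun t => f t - g t).
Proof.
  intros Hf Hg. apply pwc_ext with (fun t => f t + -1 * g t); [intros; ring|].
  apply pwc_plus; auto. now apply pwc_scal.
Qed.

Lemma continuous_shift (f : R -> R) (c : R) :
  (forall x, continuous f x) -> forall x, continuous (fun t => f (t + c)) x.
Proof.
  intros H x. apply (continuous_comp (fun t => t + c) f); auto.
  apply (continuous_plus (fun t => t) (fun _ => c)); [apply continuous_id | apply continuous_const].
Qed.

Lemma pwc_shift (f : R -> R) (m : Z) : pwc f -> pwc (fun t => f (t + IZR m)).
Proof.
  intros Hf k. destruct (Hf (k + m)%Z) as [f' [Cf Ef]].
  exists (fun t => f' (t + IZR m)). split.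
  - now apply continuous_shift.
  - intros x Hx. apply Ef. rewrite plus_IZR. lra.
Qed.

Lemma pwc_reflect (f : R -> R) (m : Z) : pwc f -> pwc (fun t => f (IZR m - t)).
Proof.
  intros Hf k. destruct (Hf (m - k - 1)%Z) as [f' [Cf Ef]].
  exists (fun t => f' (IZR m - t)). split.
  - intro x. apply (continuous_comp (fun t => IZR m - t) f'); auto.
    apply (continuous_minus (fun _ => IZR m) (fun t => t));
      [apply continuous_const | apply continuous_id].
  - intros x Hx. apply Ef. rewrite !minus_IZR. lra.
Qed.

(** Statements about oriented integrals are proved by appending one unit cell on the right; swapping
    the endpoints covers the other orientation. *)
Lemma Z_mesh_ind (P : Z -> Z -> Prop) :
  (forall a, P a a) ->
  (forall a b, (a <= b)%Z -> P a b -> P a (b + 1)%Z) ->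
  (forall a b, P a b -> P b a) ->
  forall a b, P a b.
Proof.
  intros H0 HS Hsym.
  assert (H : forall a b, (a <= b)%Z -> P a b).
  { intros a b Hab. replace b with (a + Z.of_nat (Z.to_nat (b - a)))%Z by lia.
    induction (Z.to_nat (b - a)) as [|k IH].
    - now rewrite Z.add_0_r.
    - replace (a + Z.of_nat (S k))%Z with (a + Z.of_nat k + 1)%Z by lia.
      apply HS; [lia | exact IH]. }
  intros a b. destruct (Z_le_gt_dec a b); [auto | apply Hsym, H; lia].
Qed.

Lemma continuous_ex_RInt (g : R -> R) (a b : R) :
  (forall x, continuous g x) -> ex_RInt g a b.
Proof. intro H. apply (ex_RInt_continuous (V := R_CompleteNormedModule)). auto. Qed.

Lemma pwc_ex_RInt (f : R -> R) (a b : Z) : pwc f -> ex_RInt f (IZR a) (IZR b).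
Proof.
  intro Hf. revert a b. apply Z_mesh_ind.
  - intro a. apply ex_RInt_point.
  - intros a b _ H. apply ex_RInt_Chasles with (IZR b); auto.
    rewrite plus_IZR. destruct (Hf b) as [g [Cg Eg]].
    apply ex_RInt_ext with g; [| now apply continuous_ex_RInt].
    intros x Hx. rewrite Rmin_left, Rmax_right in Hx by lra.
    symmetry; apply Eg; lra.
  - intros a b. apply ex_RInt_swap.
Qed.

(** Integrability of [g] is part of the conclusion, so [g] may be a product of [Derive_n] terms
    whose values at the breakpoints are unknown. *)
Lemma RInt_ext_nonint (f g : R -> R) (a b : Z) :
  pwc f -> (forall t, nonint t -> Rmin (IZR a) (IZR b) < t < Rmax (IZR a) (IZR b) -> f t = g t) ->
  is_RInt g (IZR a) (IZR b) (RInt f (IZR a) (IZR b)).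
Proof.
  intros Hf. revert a b. apply (Z_mesh_ind (fun a b => (forall t, nonint t -> Rmin (IZR a) (IZR b) < t < Rmax (IZR a) (IZR b) -> f t = g t) ->
  is_RInt g (IZR a) (IZR b) (RInt f (IZR a) (IZR b)))).
  - intros a _. rewrite RInt_point. apply (is_RInt_point g).
  - intros a b Hab IH E. pose proof (IZR_le _ _ Hab).
    rewrite plus_IZR in *. rewrite Rmin_left, Rmax_right in E by lra.
    rewrite Rmin_left, Rmax_right in IH by lra.
    assert (I : ex_RInt f (IZR b) (IZR b + 1))
      by (rewrite <- plus_IZR; now apply pwc_ex_RInt).
    rewrite <- (RInt_Chasles f _ (IZR b)); [| now apply pwc_ex_RInt | exact I].
    apply (is_RInt_Chasles g _ (IZR b)).
    + apply IH. intros t Ht Htt. apply E; auto. lra.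
    + apply is_RInt_ext with f; [| now apply (RInt_correct f)].
      intros x Hx. rewrite Rmin_left, Rmax_right in Hx by lra.
      apply E; [now exists b | lra].
  - intros a b H E. rewrite <- opp_RInt_swap by now apply pwc_ex_RInt.
    apply (is_RInt_swap g). apply H. rewrite Rmin_comm, Rmax_comm. exact E.
Qed.

Lemma RInt_eq_nonint (f g : R -> R) (a b : Z) :
  pwc f -> (forall t, nonint t -> Rmin (IZR a) (IZR b) < t < Rmax (IZR a) (IZR b) -> f t = g t) ->
  RInt f (IZR a) (IZR b) = RInt g (IZR a) (IZR b).
Proof. intros Hf E. symmetry. apply is_RInt_unique. now apply RInt_ext_nonint. Qed.

Lemma RInt_zero_nonint (f : R -> R) (a b : Z) :
  (forall t, nonint t -> Rmin (IZR a) (IZR b) < t < Rmax (IZR a) (IZR b) -> f t = 0) ->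
  RInt f (IZR a) (IZR b) = 0.
Proof.
  intro E. rewrite <- (RInt_eq_nonint (fun _ => 0)).
  - rewrite RInt_const. unfold scal; simpl; unfold mult; simpl; ring.
  - apply pwc_continuous. intro; apply continuous_const.
  - intros t H1 H2. symmetry; auto.
Qed.

Lemma RInt_reflect (f : R -> R) (m a b : Z) : pwc f ->
  RInt (fun t => f (IZR m - t)) (IZR a) (IZR b) = RInt f (IZR (m - b)) (IZR (m - a)).
Proof.
  intro Hf.
  rewrite <- (opp_RInt_swap f) by now apply pwc_ex_RInt.
  pose proof (RInt_comp_lin f (-1) (IZR m) (IZR a) (IZR b)) as H.
  replace (-1 * IZR a + IZR m) with (IZR (m - a)) in H by (rewrite minus_IZR; ring).
  replace (-1 * IZR b + IZR m) with (IZR (m - b)) in H by (rewrite minus_IZR; ring).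
  rewrite <- H by now apply pwc_ex_RInt.
  rewrite <- (RInt_opp (V := R_CompleteNormedModule)).
  - apply RInt_ext. intros x _. unfold scal, opp; simpl; unfold mult; simpl.
    replace (-1 * x + IZR m) with (IZR m - x) by ring. ring.
  - apply ex_RInt_ext with (fun t => -1 * f (IZR m - t)).
    + intros x _. unfold scal; simpl; unfold mult; simpl. do 2 f_equal. ring.
    + apply pwc_ex_RInt. apply pwc_scal. now apply pwc_reflect.
Qed.

Lemma RInt_shift (f : R -> R) (m a b : Z) : pwc f ->
  RInt (fun t => f (t + IZR m)) (IZR a) (IZR b) = RInt f (IZR (a + m)) (IZR (b + m)).
Proof.
  intro Hf.
  pose proof (RInt_comp_lin f 1 (IZR m) (IZR a) (IZR b)) as H.
  rewrite !Rmult_1_l, <- !plus_IZR in H.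
  rewrite <- H by now apply pwc_ex_RInt.
  apply RInt_ext. intros x _. unfold scal; simpl; unfold mult; simpl.
  now rewrite !Rmult_1_l.
Qed.

Lemma is_derive_RInt_continuous (g : R -> R) (a x : R) :
  (forall t, continuous g t) -> is_derive (RInt g a) x (g x).
Proof.
  intro C. apply is_derive_RInt with a; auto.
  exists posreal_one. intros y _. apply (RInt_correct g). now apply continuous_ex_RInt.
Qed.

(** [F] may have corners at [a] and [b]. The difference of [F] and the integral of [g] is continuous
    up to the endpoints with zero derivative inside, so the mean value theorem makes it constant. *)
Lemma FTC_interior (F g : R -> R) (a b : R) :
  a <= b ->
  (forall x, continuous F x) -> (forall x, continuous g x) ->
  (forall x, a < x < b -> is_derive F x (g x)) ->
  RInt g a b = F b - F a.
Proof.
  intros Hab CF Cg HD.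
  destruct (MVT_gen (fun x => F x - RInt g a x) a b (fun _ => 0)) as [c [_ Hc]].
  - intros x Hx. rewrite Rmin_left, Rmax_right in Hx by lra.
    replace 0 with (minus (g x) (g x)) by (unfold minus, plus, opp; simpl; ring).
    apply (is_derive_minus F (RInt g a)); [now apply HD | now apply is_derive_RInt_continuous].
  - intros x _. apply continuity_pt_filterlim.
    apply (continuous_minus F (RInt g a)); auto.
    apply (ex_derive_continuous (RInt g a)). exists (g x). now apply is_derive_RInt_continuous.
  - rewrite RInt_point in Hc. unfold zero in Hc; simpl in Hc. lra.
Qed.

Lemma FTC_pwc (F f : R -> R) (a b : Z) :
  (forall x, continuous F x) -> pwc f ->
  (forall x, nonint x -> is_derive F x (f x)) ->
  RInt f (IZR a) (IZR b) = F (IZR b) - F (IZR a).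
Proof.
  intros CF Hf HD. revert a b.
  apply (Z_mesh_ind (fun a b => RInt f (IZR a) (IZR b) = F (IZR b) - F (IZR a))).
  - intro a. rewrite RInt_point. unfold zero; simpl; ring.
  - intros a b _ H.
    rewrite <- (RInt_Chasles f _ (IZR b)) by now apply pwc_ex_RInt.
    destruct (Hf b) as [g [Cg Eg]]. unfold plus; simpl.
    rewrite H, plus_IZR.
    rewrite (RInt_ext f g).
    + rewrite (FTC_interior F); auto; try lra. intros x Hx. rewrite <- Eg by auto.
      apply HD. now exists b.
    + intros x Hx. rewrite Rmin_left, Rmax_right in Hx by lra. auto.
  - intros a b H. rewrite <- opp_RInt_swap by now apply pwc_ex_RInt.
    rewrite H. unfold opp; simpl; ring.
Qed.

(** On both sides of an integer k, [F] equals F(k) plus the integral of [g] from k. As [g] is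
    continuous, that integral is differentiable at k itself. *)
Lemma is_derive_from_nonint (F g : R -> R) :
  (forall x, continuous F x) -> (forall x, continuous g x) ->
  (forall x, nonint x -> is_derive F x (g x)) ->
  forall x, is_derive F x (g x).
Proof.
  intros CF Cg HD x. destruct (integer_or_nonint x) as [Hx | [k ->]]; auto.
  assert (E : forall y, IZR k - 1 < y < IZR k + 1 -> RInt g (IZR k) y + F (IZR k) = F y).
  { intros y Hy. destruct (Rle_dec (IZR k) y) as [L | L].
    - rewrite (FTC_interior F g (IZR k) y); auto; [ring|].
      intros z Hz. apply HD. exists k. lra.
    - rewrite <- (opp_RInt_swap g) by now apply continuous_ex_RInt.
      rewrite (FTC_interior F g y (IZR k)); auto; try lra; [unfold opp; simpl; ring|].
      intros z Hz. apply HD. exists (k - 1)%Z. rewrite minus_IZR. lra. }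
  apply is_derive_ext_loc with (fun y => RInt g (IZR k) y + F (IZR k)).
  - exists posreal_one. intros y Hy. apply E.
    unfold ball in Hy; simpl in Hy; unfold AbsRing_ball, abs, minus, plus, opp in Hy; simpl in Hy.
    apply Rabs_def2 in Hy. lra.
  - rewrite <- (Rplus_0_r (g (IZR k))).
    apply (is_derive_plus (RInt g (IZR k)) (fun _ => F (IZR k))).
    + now apply is_derive_RInt_continuous.
    + apply @is_derive_const.
Qed.

(* Coquelicot leaves equations typed in a canonical structure over [R]. *)
Ltac R_eq := lazymatch goal with |- @eq _ ?x ?y => change (@eq R x y) end.

(** * Splines and backward differences *)

Lemma cardN_S (q : nat) (t : R) :
  cardN (S q) t = t / INR (S q) * cardN q t
                  + (INR (S q) + 1 - t) / INR (S q) * cardN q (t - 1).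
Proof. reflexivity. Qed.

Lemma cardN_lt0 (p : nat) (t : R) : t < 0 -> cardN p t = 0.
Proof.
  revert t. induction p as [|q IH]; intros t Ht.
  - simpl. destruct (Rle_dec 0 t); lra.
  - rewrite cardN_S, !IH by lra. ring.
Qed.

Lemma cardN_ge (p : nat) (t : R) : INR p + 1 <= t -> cardN p t = 0.
Proof.
  revert t. induction p as [|q IH]; intros t Ht.
  - simpl in *. destruct (Rle_dec 0 t), (Rlt_dec t 1); lra.
  - rewrite cardN_S. rewrite S_INR in Ht. rewrite !IH by lra. ring.
Qed.

Lemma cardN_S_at0 (q : nat) : cardN (S q) 0 = 0.
Proof. rewrite cardN_S, (cardN_lt0 q (0 - 1)) by lra. lra. Qed.

Lemma cardN0_cell (k : Z) (t : R) :
  IZR k < t < IZR k + 1 -> cardN 0 t = if Z.eq_dec k 0 then 1 else 0.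
Proof.
  intros Ht. simpl. destruct (Z.eq_dec k 0) as [-> | N].
  - destruct (Rle_dec 0 t), (Rlt_dec t 1); lra.
  - assert (k <= -1 \/ 1 <= k)%Z as [L | L] by lia; apply IZR_le in L;
    destruct (Rle_dec 0 t), (Rlt_dec t 1); lra.
Qed.

Lemma pwc_cardN (p : nat) : pwc (cardN p).
Proof.
  induction p as [|q IH].
  - intro k. exists (fun _ => if Z.eq_dec k 0 then 1 else 0). split.
    + intro. apply continuous_const.
    + apply cardN0_cell.
  (* [t - 1] is convertible with [t + IZR (-1)], the form that [pwc_shift] produces. *)
  - apply pwc_ext with (fun t => t / INR (S q) * cardN q t
           + (INR (S q) + 1 - t) / INR (S q) * cardN q (t + IZR (-1))); [reflexivity|].
    pose proof (not_0_INR (S q) ltac:(lia)).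
    apply pwc_plus; apply pwc_mult; auto using pwc_shift;
    apply pwc_continuous; intro x; apply @ex_derive_continuous;
    auto_derive; auto.
Qed.

Lemma is_derive_cardN0 (t : R) : nonint t -> is_derive (cardN 0) t 0.
Proof.
  intro Ht. destruct Ht as [k Hk].
  apply is_derive_ext_loc with (fun _ => if Z.eq_dec k 0 then 1 else 0).
  - assert (He : 0 < Rmin (t - IZR k) (IZR k + 1 - t)) by (apply Rmin_glb_lt; lra).
    exists (mkposreal _ He). intros y Hy. symmetry. apply cardN0_cell.
    unfold ball in Hy; simpl in Hy; unfold AbsRing_ball, abs, minus, plus, opp in Hy; simpl in Hy.
    pose proof (Rmin_l (t - IZR k) (IZR k + 1 - t)).
    pose proof (Rmin_r (t - IZR k) (IZR k + 1 - t)).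
    apply Rabs_def2 in Hy. lra.
  - apply (is_derive_const (V := R_NormedModule)).
Qed.

Lemma is_derive_shift (f : R -> R) (t c l : R) :
  is_derive f (t + c) l -> is_derive (fun u => f (u + c)) t l.
Proof.
  intro H. rewrite <- (Rmult_1_l l).
  apply (is_derive_comp f (fun u => u + c) t l 1); [exact H|].
  auto_derive; auto.
Qed.

(** Product rule on the recursion, with the two inner derivatives left open so that the induction
    for the difference formula can supply them. *)
Lemma is_derive_cardN_S_recursion (q : nat) (t dl dr : R) :
  is_derive (cardN q) t dl -> is_derive (cardN q) (t - 1) dr ->
  is_derive (cardN (S q)) t
    ((cardN q t + t * dl - cardN q (t - 1) + (INR (S q) + 1 - t) * dr) / INR (S q)).
Proof.
  intros Hl Hr. pose proof (not_0_INR (S q) ltac:(lia)) as N.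
  apply is_derive_ext with (fun t => / INR (S q) * (t * cardN q t + (INR (S q) + 1 - t) * cardN q (t + -1))).
  { intro u. rewrite cardN_S. change (u + -1) with (u - 1). R_eq. field. exact N. }
  replace (_ / INR (S q)) with
    (/ INR (S q) * ((1 * cardN q t + t * dl) + (-1 * cardN q (t + -1) + (INR (S q) + 1 - t) * dr)))
    by (change (t + -1) with (t - 1); field; exact N).
  apply is_derive_scal.
  apply (is_derive_plus (fun t => t * cardN q t) (fun t => (INR (S q) + 1 - t) * cardN q (t + -1))).
  - apply (is_derive_mult (fun t => t) (cardN q)); auto.
    + apply (is_derive_id (K := R_AbsRing)).
    + exact Rmult_comm.
  - apply (is_derive_mult (fun t => INR (S q) + 1 - t) (fun t => cardN q (t + -1))).
    + auto_derive; auto; ring.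
    + now apply is_derive_shift.
    + exact Rmult_comm.
Qed.

Lemma is_derive_cardN_nonint (q : nat) (t : R) :
  nonint t -> is_derive (cardN (S q)) t (cardN q t - cardN q (t - 1)).
Proof.
  revert t. induction q as [|q IH]; intros t Ht.
  - replace (cardN 0 t - cardN 0 (t - 1)) with
      ((cardN 0 t + t * 0 - cardN 0 (t - 1) + (INR 1 + 1 - t) * 0) / INR 1)
      by (change (INR 1) with 1; field).
    apply is_derive_cardN_S_recursion; apply is_derive_cardN0; auto using nonint_minus1.
  - pose proof (is_derive_cardN_S_recursion _ _ _ _ (IH _ Ht) (IH _ (nonint_minus1 _ Ht))) as H.
    evar_last; [exact H|]. R_eq. rewrite !cardN_S.
    pose proof (not_0_INR (S q) ltac:(lia)) as N.
    rewrite (S_INR (S q)) in *.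
    assert (0 < INR (S q)) by (apply lt_0_INR; lia).
    field. split; lra.
Qed.

Lemma continuous_cardN (q : nat) (t : R) : continuous (cardN (S q)) t.
Proof.
  revert t. induction q as [|q IH]; intro t.
  (* The hat function is half the second difference of the absolute value, which makes its
     continuity immediate. *)
  - apply continuous_ext with (fun t => / 2 * (Rabs t - 2 * Rabs (t + -1) + Rabs (t + -2))).
    + intro u. R_eq. rewrite cardN_S. change (INR 1) with 1. unfold Rabs. simpl.
      destruct (Rcase_abs u), (Rcase_abs (u + -1)), (Rcase_abs (u + -2)),
        (Rle_dec 0 u), (Rlt_dec u 1), (Rle_dec 0 (u - 1)), (Rlt_dec (u - 1) 1); lra.
    + assert (C : forall c x, continuous (fun t => Rabs (t + c)) x)
        by (intro c; apply (continuous_shift Rabs); intro; apply continuous_Rabs).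
      apply (continuous_mult (fun _ => / 2)); [apply continuous_const|].
      apply (continuous_plus (fun t => Rabs t - 2 * Rabs (t + -1))); [|apply C].
      apply (continuous_minus Rabs); [apply continuous_Rabs|].
      apply (continuous_mult (fun _ => 2)); [apply continuous_const | apply C].
  - pose proof (not_0_INR (S (S q)) ltac:(lia)).
    apply (continuous_plus (fun t => t / INR (S (S q)) * cardN (S q) t)
      (fun t => (INR (S (S q)) + 1 - t) / INR (S (S q)) * cardN (S q) (t + -1))).
    + apply (continuous_mult (fun t => t / INR (S (S q)))); auto.
      apply (ex_derive_continuous (V := R_NormedModule)). auto_derive; auto.
    + apply (continuous_mult (fun t => (INR (S (S q)) + 1 - t) / INR (S (S q)))).
      * apply (ex_derive_continuous (V := R_NormedModule)). auto_derive; auto.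
      * now apply continuous_shift.
Qed.

(* [cardN 1] has corners at 0, 1, 2: there the derivative formula fails. *)
Definition regular (q : nat) (t : R) : Prop := (1 <= q)%nat \/ nonint t.

Lemma regular_minus1 (q : nat) (t : R) : regular q t -> regular q (t - 1).
Proof. intros [H | H]; [now left | right; now apply nonint_minus1]. Qed.

(** For q at least 1 the right-hand side is continuous, so the formula extends from the open cells
    to the integers. *)
Lemma is_derive_cardN (q : nat) (t : R) :
  regular q t -> is_derive (cardN (S q)) t (cardN q t - cardN q (t - 1)).
Proof.
  intros [Hq | Ht]; [| now apply is_derive_cardN_nonint].
  destruct q as [|q]; [lia|].
  apply (is_derive_from_nonint (cardN (S (S q))) (fun t => cardN (S q) t - cardN (S q) (t - 1))).
  - apply continuous_cardN.
  - intro x. apply (continuous_minus (cardN (S q)) (fun t => cardN (S q) (t + -1))).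
    + apply continuous_cardN.
    + apply continuous_shift, continuous_cardN.
  - apply is_derive_cardN_nonint.
Qed.

Fixpoint bdiff (r : nat) (f : R -> R) : R -> R :=
  match r with
  | O => f
  | S r' => fun t => bdiff r' f t - bdiff r' f (t - 1)
  end.

Lemma bdiff_S (r : nat) (f : R -> R) (t : R) :
  bdiff (S r) f t = bdiff r f t - bdiff r f (t - 1).
Proof. reflexivity. Qed.

Lemma bdiff_Sr (r : nat) (f : R -> R) (t : R) :
  bdiff r (fun t => f t - f (t - 1)) t = bdiff (S r) f t.
Proof.
  revert t. induction r as [|r IH]; intro t; [reflexivity|].
  rewrite bdiff_S, !IH. reflexivity.
Qed.

(** The differences sample [f] at t, t - 1, ..., t - r, hence [P] has to be stable under a step to
    the left. *)
Lemma is_derive_bdiff (r : nat) (P : R -> Prop) (f g : R -> R) :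
  (forall t, P t -> P (t - 1)) -> (forall t, P t -> is_derive f t (g t)) ->
  forall t, P t -> is_derive (bdiff r f) t (bdiff r g t).
Proof.
  intros HP HD. induction r as [|r IH]; intros t Ht; [now apply HD|].
  apply (is_derive_minus (bdiff r f) (fun t => bdiff r f (t + -1))); [now apply IH|].
  apply (is_derive_shift (bdiff r f)). now apply IH, HP.
Qed.

Lemma is_derive_bdiff_cardN (r q : nat) (t : R) :
  regular q t -> is_derive (bdiff r (cardN (S q))) t (bdiff (S r) (cardN q) t).
Proof.
  intro Ht. rewrite <- bdiff_Sr.
  apply (is_derive_bdiff r (regular q) _ (fun t => cardN q t - cardN q (t - 1)));
    auto using regular_minus1, is_derive_cardN.
Qed.

Lemma pwc_bdiff (r : nat) (f : R -> R) : pwc f -> pwc (bdiff r f).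
Proof.
  intro Hf. induction r as [|r IH]; [exact Hf|].
  apply (pwc_minus (bdiff r f) (fun t => bdiff r f (t + IZR (-1)))); auto using pwc_shift.
Qed.

Lemma bdiff_lt0 (r : nat) (f : R -> R) :
  (forall t, t < 0 -> f t = 0) -> forall t, t < 0 -> bdiff r f t = 0.
Proof.
  intro Hf. induction r as [|r IH]; intros t Ht; [now apply Hf|].
  rewrite bdiff_S, !IH by lra. ring.
Qed.

Lemma bdiff_ge (r : nat) (f : R -> R) (c : R) :
  (forall t, c <= t -> f t = 0) -> forall t, c + INR r <= t -> bdiff r f t = 0.
Proof.
  intro Hf. induction r as [|r IH]; intros t Ht.
  - apply Hf. simpl in Ht. lra.
  - rewrite S_INR in Ht. rewrite bdiff_S, !IH by lra. ring.
Qed.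

(** The reflection exchanges the two terms of the recursion. Integers are excluded because [cardN 0]
    is the indicator of a half-open interval. *)
Lemma cardN_reflect (p : nat) (t : R) :
  nonint t -> cardN p (INR p + 1 - t) = cardN p t.
Proof.
  revert t. induction p as [|q IH]; intros t Ht.
  - destruct Ht as [k Hk]. rewrite (cardN0_cell k t Hk), (cardN0_cell (-k)).
    + destruct (Z.eq_dec k 0), (Z.eq_dec (-k) 0); lia || reflexivity.
    + rewrite opp_IZR. simpl. lra.
  - rewrite !cardN_S.
    replace (INR (S q) + 1 - t - 1) with (INR q + 1 - t) by (rewrite S_INR; ring).
    replace (INR (S q) + 1 - t) with (INR q + 1 - (t - 1)) at 2 by (rewrite S_INR; ring).
    rewrite !IH by auto using nonint_minus1.
    pose proof (not_0_INR (S q) ltac:(lia)). field. exact H.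
Qed.

(** Each difference moves the centre of symmetry by one half to the right and flips the parity. *)
Lemma bdiff_reflect (r : nat) (f : R -> R) (m : R) :
  (forall t, nonint t -> f (m - t) = f t) ->
  forall t, nonint t -> bdiff r f (m + INR r - t) = (-1) ^ r * bdiff r f t.
Proof.
  intro Hf. induction r as [|r IH]; intros t Ht.
  - simpl. rewrite Rplus_0_r, Hf by auto. ring.
  - rewrite !bdiff_S.
    replace (m + INR (S r) - t) with (m + INR r - (t - 1)) by (rewrite S_INR; ring).
    rewrite IH by auto using nonint_minus1.
    replace (m + INR r - (t - 1) - 1) with (m + INR r - t) by ring.
    rewrite IH by auto. simpl. ring.
Qed.

(** With r < p every derivative taken is that of a spline of degree at least 2, so the formula holds
    at all points. *)
Lemma Derive_n_cardN (p r : nat) (t : R) :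
  (r < p)%nat -> Derive_n (cardN p) r t = bdiff r (cardN (p - r)) t.
Proof.
  revert t. induction r as [|r IH]; intros t Hr.
  - simpl. now rewrite Nat.sub_0_r.
  - simpl Derive_n. rewrite (Derive_ext _ (bdiff r (cardN (p - r)))) by (intro; apply IH; lia).
    replace (p - r)%nat with (S (p - S r)) by lia.
    apply is_derive_unique, is_derive_bdiff_cardN. left. lia.
Qed.

(** * Convolution *)

(* For functions vanishing on the negative axis this is the convolution over the line. *)
Definition conv (f g : R -> R) (x : Z) : R := RInt (fun t => f t * g (IZR x - t)) 0 (IZR x).

Lemma pwc_conv (f g : R -> R) (x : Z) : pwc f -> pwc g -> pwc (fun t => f t * g (IZR x - t)).
Proof. auto using pwc_mult, pwc_reflect. Qed.

(** One factor vanishes on each added piece: [f] to the left of 0, the reflected [g] to the right of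
    x. The integrals are oriented, so x may be negative. *)
Lemma conv_wide (f g : R -> R) (x a b : Z) :
  pwc f -> pwc g -> (forall t, t < 0 -> f t = 0) -> (forall t, t < 0 -> g t = 0) ->
  (a <= 0)%Z -> (x <= b)%Z -> (a <= b)%Z ->
  RInt (fun t => f t * g (IZR x - t)) (IZR a) (IZR b) = conv f g x.
Proof.
  intros Pf Pg Cf Cg Ha Hb Hab. unfold conv.
  pose proof (pwc_conv f g x Pf Pg) as PP.
  pose proof (fun u v => pwc_ex_RInt _ u v PP) as I.
  rewrite <- (RInt_Chasles _ (IZR a) 0 (IZR b)) by apply I.
  rewrite <- (RInt_Chasles _ 0 (IZR x) (IZR b)) by apply I.
  apply IZR_le in Ha, Hb.
  rewrite (RInt_zero_nonint _ a 0), (RInt_zero_nonint _ x b).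
  - unfold plus; simpl; ring.
  - intros t _. rewrite Rmin_left, Rmax_right by lra. intro Ht. rewrite Cg by lra. ring.
  - intros t _. rewrite Rmin_left, Rmax_right by lra. intro Ht. rewrite Cf by lra. ring.
Qed.

Lemma conv_le0 (f g : R -> R) (x : Z) :
  (forall t, t < 0 -> f t = 0) -> (x <= 0)%Z -> conv f g x = 0.
Proof.
  intros Cf Hx. apply IZR_le in Hx. apply (RInt_zero_nonint _ 0).
  intros t _. rewrite Rmin_right, Rmax_left by lra. intro Ht. rewrite Cf by lra. ring.
Qed.

Lemma conv_comm (f g : R -> R) (x : Z) : pwc f -> pwc g -> conv f g x = conv g f x.
Proof.
  intros Pf Pg. unfold conv.
  pose proof (RInt_reflect _ x 0 x (pwc_conv f g x Pf Pg)) as H.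
  rewrite Z.sub_diag, Z.sub_0_r in H. rewrite <- H. apply RInt_ext.
  intros t _. R_eq. replace (IZR x - (IZR x - t)) with t by ring. ring.
Qed.

Lemma conv_bdiff1 (f g : R -> R) (x : Z) :
  pwc f -> pwc g -> (forall t, t < 0 -> f t = 0) -> (forall t, t < 0 -> g t = 0) ->
  conv (fun t => f t - f (t - 1)) g x = conv f g x - conv f g (x - 1).
Proof.
  intros Pf Pg Cf Cg.
  (* All three convolutions are put on the window from 0 to max(0, x), the one at x - 1 on its
     translate by -1. Shifting the latter back moves the shift onto [f]. *)
  rewrite <- (conv_wide f g (x - 1) (0 + -1) (Z.max 0 x + -1)) by (auto; lia).
  rewrite <- (conv_wide f g x 0 (Z.max 0 x)) by (auto; lia).
  rewrite <- (conv_wide (fun t => f t - f (t - 1)) g x 0 (Z.max 0 x)); try lia; auto.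
  2: { apply (pwc_minus f (fun t => f (t + IZR (-1)))); auto using pwc_shift. }
  2: { intros t Ht. rewrite !Cf by lra. ring. }
  rewrite <- RInt_shift by auto using pwc_conv.
  rewrite <- (RInt_minus (V := R_CompleteNormedModule)).
  - apply RInt_ext. intros t _. unfold minus, plus, opp; simpl.
    rewrite minus_IZR. R_eq. replace (IZR x - 1 - (t + -1)) with (IZR x - t) by ring.
    change (t - 1) with (t + -1). ring.
  - apply pwc_ex_RInt. auto using pwc_conv.
  - apply pwc_ex_RInt. apply (pwc_shift (fun t => f t * g (IZR (x - 1) - t)) (-1)).
    auto using pwc_conv.
Qed.

(** Differences step by 1, so knowing the convolution as [h] at the integers is enough. Those on the
    second factor are reached through commutativity. *)
Lemma conv_bdiff (r s : nat) (f g h : R -> R) :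
  pwc f -> pwc g -> (forall t, t < 0 -> f t = 0) -> (forall t, t < 0 -> g t = 0) ->
  (forall x, conv f g x = h (IZR x)) ->
  forall x, conv (bdiff r f) (bdiff s g) x = bdiff (r + s) h (IZR x).
Proof.
  intros Pf Pg Cf Cg E. induction r as [|r IH].
  - induction s as [|s IH]; [exact E|]. intro x. cbn [bdiff Nat.add] in *.
    rewrite conv_comm, conv_bdiff1; auto using pwc_bdiff, bdiff_lt0.
    + rewrite !(conv_comm _ f), !IH, minus_IZR by auto using pwc_bdiff. reflexivity.
    + apply (pwc_bdiff (S s)); auto.
  - intro x. cbn [bdiff Nat.add].
    rewrite conv_bdiff1 by auto using pwc_bdiff, bdiff_lt0.
    rewrite !IH, minus_IZR. reflexivity.
Qed.

(** Meant for convolutions: they vanish for x at most 0, and their differences in x turn spline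
    factors into derivatives, to which the fundamental theorem applies. *)
Lemma Z_eq_of_differences (u v : Z -> R) :
  (forall x, (x <= 0)%Z -> u x = v x) ->
  (forall x, u x - u (x - 1)%Z = v x - v (x - 1)%Z) ->
  forall x, u x = v x.
Proof.
  intros H0 HD x. destruct (Z_le_gt_dec x 0) as [L | L]; auto.
  replace x with (Z.of_nat (Z.to_nat x)) by lia.
  induction (Z.to_nat x) as [|k IH]; [now apply H0|].
  specialize (HD (Z.of_nat (S k))).
  replace (Z.of_nat (S k) - 1)%Z with (Z.of_nat k) in HD by lia. lra.
Qed.

Lemma conv_cardN0 (f : R -> R) (x : Z) :
  pwc f -> (forall t, t < 0 -> f t = 0) ->
  conv f (cardN 0) x = RInt f (IZR (x - 1)) (IZR x).
Proof.
  intros Pf Cf.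
  (* The window must contain the cell from x - 1 to x, on which [cardN 0 (IZR x - t)] is 1; this
     cell may start left of 0. *)
  rewrite <- (conv_wide f (cardN 0) x (Z.min 0 (x - 1)) x)
    by (auto using pwc_cardN, cardN_lt0; lia).
  assert (PP := pwc_conv f (cardN 0) x Pf (pwc_cardN 0)).
  rewrite <- (RInt_Chasles _ _ (IZR (x - 1))) by (apply pwc_ex_RInt; auto).
  assert (L : IZR (Z.min 0 (x - 1)) <= IZR (x - 1)) by (apply IZR_le; lia).
  rewrite RInt_zero_nonint, (RInt_eq_nonint _ f); auto.
  - unfold plus; simpl; ring.
  - intros t _. rewrite minus_IZR, Rmin_left, Rmax_right by lra. intro Ht.
    rewrite (cardN0_cell 0) by lra. simpl. ring.
  - intros t _. rewrite Rmin_left, Rmax_right by lra. rewrite minus_IZR. intro Ht.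
    rewrite cardN_ge by (simpl; lra). ring.
Qed.

(** The difference in x of the left side is the integral over the last cell of [h], the derivative
    of [cardN (S a)]; hence it is the difference of the right side. *)
Lemma conv_cardN_cardN0 (a : nat) (x : Z) : conv (cardN a) (cardN 0) x = cardN (S a) (IZR x).
Proof.
  revert x. apply Z_eq_of_differences.
  - intros x Hx. rewrite conv_le0 by (auto using cardN_lt0).
    apply IZR_le in Hx. destruct (Req_dec (IZR x) 0) as [-> | N].
    + now rewrite cardN_S_at0.
    + rewrite cardN_lt0 by lra. reflexivity.
  - intro x. rewrite <- conv_bdiff1 by auto using pwc_cardN, cardN_lt0.
    set (h := fun t => cardN a t - cardN a (t - 1)).
    assert (Ph : pwc h).
    { apply (pwc_minus _ (fun t => cardN a (t + IZR (-1)))); auto using pwc_shift, pwc_cardN. }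
    rewrite <- (FTC_pwc (cardN (S a)) h (x - 1) x);
      auto using continuous_cardN, is_derive_cardN_nonint.
    apply conv_cardN0; [exact Ph | intros t Ht; unfold h; rewrite !cardN_lt0 by lra; ring].
Qed.

(** After differencing in x, the two integrands differ by the derivative of
    [cardN (S a) t * cardN (S b) (IZR x - t)]. This product vanishes at 0 and at x, where one factor
    is a spline of positive degree at 0. *)
Lemma conv_cardN_shift_degree (a b : nat) (x : Z) :
  conv (cardN a) (cardN (S b)) x = conv (cardN (S a)) (cardN b) x.
Proof.
  revert x. apply Z_eq_of_differences.
  - intros x Hx. rewrite !conv_le0 by (auto using cardN_lt0). reflexivity.
  - intro x.
    rewrite <- conv_bdiff1 by auto using pwc_cardN, cardN_lt0.
    rewrite !(conv_comm (cardN (S a))) by auto using pwc_cardN.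
    rewrite <- conv_bdiff1 by auto using pwc_cardN, cardN_lt0.
    assert (P : forall c, pwc (fun t => cardN c t - cardN c (t - 1))).
    { intro c. apply (pwc_minus _ (fun t => cardN c (t + IZR (-1)))); auto using pwc_shift, pwc_cardN. }
    rewrite (conv_comm _ (cardN (S a))) by auto using pwc_cardN.
    apply Rminus_diag_uniq. unfold conv.
    pose proof (pwc_conv _ _ x (P a) (pwc_cardN (S b))) as P1.
    pose proof (pwc_conv _ _ x (pwc_cardN (S a)) (P b)) as P2.
    rewrite <- (RInt_minus (V := R_CompleteNormedModule)) by now apply (pwc_ex_RInt _ 0).
    rewrite (FTC_pwc (fun t => cardN (S a) t * cardN (S b) (IZR x - t)) _ 0 x).
    + rewrite Rminus_diag, !cardN_S_at0. ring.
    + intro t. apply (continuous_mult (cardN (S a)) (fun t => cardN (S b) (IZR x - t))).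
      * apply continuous_cardN.
      * apply (continuous_comp (fun t => IZR x - t) (cardN (S b))); [| apply continuous_cardN].
        apply (continuous_minus (fun _ => IZR x) (fun t => t)); [apply continuous_const | apply continuous_id].
    + exact (pwc_minus _ _ P1 P2).
    + intros t Ht. unfold minus, plus, opp; simpl.
      evar_last.
      * apply (is_derive_mult (cardN (S a)) (fun t => cardN (S b) (IZR x - t))).
        -- now apply is_derive_cardN_nonint.
        -- apply (is_derive_comp (cardN (S b)) (fun t => IZR x - t) t
                    (cardN b (IZR x - t) - cardN b (IZR x - t - 1)) (-1)).
           ++ apply is_derive_cardN_nonint. now apply nonint_IZR_minus.
           ++ auto_derive; auto; ring.
        -- exact Rmult_comm.
      * unfold plus, mult, scal; simpl; unfold mult; simpl. ring.
Qed.

Lemma conv_cardN (a b : nat) (x : Z) :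
  conv (cardN a) (cardN b) x = cardN (S (a + b)) (IZR x).
Proof.
  revert a. induction b as [|b IH]; intro a.
  - rewrite Nat.add_0_r. apply conv_cardN_cardN0.
  - rewrite conv_cardN_shift_degree, IH. do 2 f_equal. lia.
Qed.

Lemma conv_bdiff_cardN (r q : nat) (x : Z) :
  conv (bdiff r (cardN q)) (bdiff r (cardN q)) x
  = bdiff (2 * r) (cardN (2 * q + 1)) (IZR x).
Proof.
  replace (2 * r)%nat with (r + r)%nat by lia.
  apply conv_bdiff; auto using pwc_cardN, cardN_lt0.
  intro y. rewrite conv_cardN. do 2 f_equal. lia.
Qed.

(** * Gram integrals *)

(** The factors are supported on [A, A + p + 1] and [B, B + p + 1], so their overlap can only be
    [A, B + p + 1], and the bounds on L and U keep it inside the interval. Reflecting one factor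
    about (p + 1) / 2 gives a convolution at p + 1 - (A - B). *)
Lemma RInt_correlation (p r : nat) (A B L U : Z) :
  (r <= p)%nat -> (B <= A)%Z -> (L <= A)%Z -> (L <= U)%Z -> (B + Z.of_nat p + 1 <= U)%Z ->
  let f := bdiff r (cardN (p - r)) in
  RInt (fun y => f (y + IZR (- A)) * f (y + IZR (- B))) (IZR L) (IZR U)
  = alpha p r (Z.to_nat (A - B)).
Proof.
  intros Hr HBA HL HLU HU f.
  assert (Pf : pwc f) by apply pwc_bdiff, pwc_cardN.
  assert (Cf : forall t, t < 0 -> f t = 0) by apply bdiff_lt0, cardN_lt0.
  set (x := (Z.of_nat p + 1 - (A - B))%Z).
  assert (E : forall t, nonint t -> f (t + IZR (A - B)) = (-1) ^ r * f (IZR x - t)).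
  { intros t Ht. unfold f. rewrite <- (bdiff_reflect r _ (INR (p - r) + 1)).
    - f_equal. unfold x. rewrite !minus_IZR, plus_IZR, <- INR_IZR_INZ, minus_INR by lia. ring.
    - apply cardN_reflect.
    - now apply nonint_IZR_minus. }
  pose proof (pwc_conv f f x Pf Pf) as PP.
  transitivity (RInt (fun t => (-1) ^ r * (f t * f (IZR x - t))) (IZR (L + - A)) (IZR (U + - A))).
  { rewrite <- RInt_shift by now apply pwc_scal. apply RInt_eq_nonint.
    - apply pwc_mult; now apply pwc_shift.
    - intros t Ht _. replace (t + IZR (- B)) with (t + IZR (- A) + IZR (A - B))
        by (rewrite minus_IZR, !opp_IZR; ring).
      rewrite E by now apply nonint_plus_IZR. ring. }
  rewrite (RInt_scal (V := R_CompleteNormedModule) (fun t => f t * f (IZR x - t)) _ _ ((-1) ^ r)) by now apply pwc_ex_RInt.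
  rewrite conv_wide by (auto; unfold x; lia).
  unfold alpha, scal; simpl; unfold mult; simpl.
  destruct (Nat.leb_spec (Z.to_nat (A - B)) p) as [K | K].
  - fold (2 * r)%nat (2 * p)%nat. f_equal. unfold f. rewrite conv_bdiff_cardN, Derive_n_cardN by lia.
    replace (2 * p + 1 - 2 * r)%nat with (2 * (p - r) + 1)%nat by lia.
    f_equal. rewrite INR_IZR_INZ. f_equal. unfold x. lia.
  (* Here A - B > p: the supports do not overlap, and [alpha] takes its default value 0. *)
  - rewrite conv_le0 by (auto; unfold x; lia). ring.
Qed.

Lemma RInt_pwc_plus (f g : R -> R) (a b : Z) : pwc f -> pwc g ->
  RInt (fun t => f t + g t) (IZR a) (IZR b) = RInt f (IZR a) (IZR b) + RInt g (IZR a) (IZR b).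
Proof. intros. apply (RInt_plus f g); now apply pwc_ex_RInt. Qed.

Lemma RInt_pwc_minus (f g : R -> R) (a b : Z) : pwc f -> pwc g ->
  RInt (fun t => f t - g t) (IZR a) (IZR b) = RInt f (IZR a) (IZR b) - RInt g (IZR a) (IZR b).
Proof. intros. apply (RInt_minus f g); now apply pwc_ex_RInt. Qed.

(** Both factors acquire the same sign under the reflection, so it cancels in the product. *)
Lemma RInt_product_reflect (e : R) (u v u' v' : R -> R) (m a b : Z) :
  e * e = 1 -> pwc u' -> pwc v' ->
  (forall t, nonint t -> u (IZR m - t) = e * u' t) ->
  (forall t, nonint t -> v (IZR m - t) = e * v' t) ->
  RInt (fun t => u t * v t) (IZR a) (IZR b)
  = RInt (fun t => u' t * v' t) (IZR (m - b)) (IZR (m - a)).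
Proof.
  intros He Pu Pv Hu Hv.
  rewrite <- RInt_reflect by now apply pwc_mult.
  symmetry. apply RInt_eq_nonint.
  - apply (pwc_reflect (fun t => u' t * v' t)). now apply pwc_mult.
  - intros t Ht _.
    replace t with (IZR m - (IZR m - t)) at 3 4 by ring.
    rewrite Hu, Hv by now apply nonint_IZR_minus.
    transitivity ((e * e) * (u' (IZR m - t) * v' (IZR m - t))); [rewrite He|]; ring.
Qed.

Lemma reflect_symmetric (e : R) (m : Z) (u v : R -> R) :
  e * e = 1 -> (forall t, nonint t -> u (IZR m - t) = e * v t) ->
  forall t, nonint t -> v (IZR m - t) = e * u t.
Proof.
  intros He H t Ht. replace t with (IZR m - (IZR m - t)) at 2 by ring.
  rewrite H by now apply nonint_IZR_minus. rewrite <- Rmult_assoc, He. ring.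
Qed.

(* [q] and [s] are the mirror images of [f] at 0 and n, up to the sign [e]:
   the seven surviving products on [0, n] glue to three integrals of products
   with [f] over longer intervals. *)
Lemma RInt_unfold_reflections (e : R) (n : Z) (f q s f' q' s' : R -> R) :
  e * e = 1 -> (0 <= n)%Z ->
  pwc f -> pwc q -> pwc s -> pwc f' -> pwc q' -> pwc s' ->
  (forall t, nonint t -> q (0 - t) = e * f t) ->
  (forall t, nonint t -> q' (0 - t) = e * f' t) ->
  (forall t, nonint t -> s (IZR (2 * n) - t) = e * f t) ->
  (forall t, nonint t -> s' (IZR (2 * n) - t) = e * f' t) ->
  (forall t, 0 < t < IZR n -> q t * s' t = 0) ->
  (forall t, 0 < t < IZR n -> s t * q' t = 0) ->
  RInt (fun t => (f t - q t - s t) * (f' t - q' t - s' t)) 0 (IZR n)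
  = RInt (fun t => f t * f' t) (IZR (- n)) (IZR (2 * n))
    - RInt (fun t => f t * q' t) (IZR (- n)) (IZR n)
    - RInt (fun t => f t * s' t) 0 (IZR (2 * n)).
Proof.
  intros He Hn Pf Pq Ps Pf' Pq' Ps' Eq Eq' Es Es' Z1 Z2.
  pose proof (reflect_symmetric e 0 q f He Eq) as Fq.
  pose proof (reflect_symmetric e 0 q' f' He Eq') as Fq'.
  pose proof (reflect_symmetric e (2 * n) s' f' He Es') as Fs'.
  (* Reflection at 0 exchanges [q] with [f] and carries [0, n] to [-n, 0]; reflection at n does the
     same for [s] with [n, 2n]. *)
  assert (qq : RInt (fun t => q t * q' t) 0 (IZR n) = RInt (fun t => f t * f' t) (IZR (- n)) 0)
    by now rewrite (RInt_product_reflect e q q' f f' 0 0 n) by auto.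
  assert (qf : RInt (fun t => q t * f' t) 0 (IZR n) = RInt (fun t => f t * q' t) (IZR (- n)) 0)
    by now rewrite (RInt_product_reflect e q f' f q' 0 0 n) by auto.
  assert (ss : RInt (fun t => s t * s' t) 0 (IZR n) = RInt (fun t => f t * f' t) (IZR n) (IZR (2 * n))).
  { rewrite (RInt_product_reflect e s s' f f' (2 * n) 0 n) by auto. do 2 f_equal; lia. }
  assert (sf : RInt (fun t => s t * f' t) 0 (IZR n) = RInt (fun t => f t * s' t) (IZR n) (IZR (2 * n))).
  { rewrite (RInt_product_reflect e s f' f s' (2 * n) 0 n) by auto. do 2 f_equal; lia. }
  pose proof (pwc_mult _ _ Pf Pf') as Pff.
  pose proof (pwc_mult _ _ Pq Pq') as Pqq.
  pose proof (pwc_mult _ _ Ps Ps') as Pss.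
  pose proof (pwc_mult _ _ Pf Pq') as Pfq.
  pose proof (pwc_mult _ _ Pq Pf') as Pqf.
  pose proof (pwc_mult _ _ Pf Ps') as Pfs.
  pose proof (pwc_mult _ _ Ps Pf') as Psf.
  apply IZR_le in Hn.
  rewrite (RInt_eq_nonint _ (fun t => (f t * f' t + q t * q' t + s t * s' t)
     - (f t * q' t + q t * f' t + (f t * s' t + s t * f' t))) 0 n).
  - rewrite RInt_pwc_minus by auto using pwc_plus.
    rewrite !RInt_pwc_plus by auto using pwc_plus.
    rewrite qq, qf, ss, sf.
    pose proof (RInt_Chasles (V := R_CompleteNormedModule) _ _ _ _ (pwc_ex_RInt _ (- n) 0 Pff) (pwc_ex_RInt _ 0 n Pff)) as C1.
    pose proof (RInt_Chasles (V := R_CompleteNormedModule) _ _ _ _ (pwc_ex_RInt _ (- n) n Pff) (pwc_ex_RInt _ n (2 * n) Pff)) as C2.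
    pose proof (RInt_Chasles (V := R_CompleteNormedModule) _ _ _ _ (pwc_ex_RInt _ (- n) 0 Pfq) (pwc_ex_RInt _ 0 n Pfq)) as C3.
    pose proof (RInt_Chasles (V := R_CompleteNormedModule) _ _ _ _ (pwc_ex_RInt _ 0 n Pfs) (pwc_ex_RInt _ n (2 * n) Pfs)) as C4.
    rewrite <- C2, <- C1, <- C3, <- C4. unfold plus; simpl. ring.
  - apply pwc_mult; auto using pwc_minus.
  - intros t _. rewrite Rmin_left, Rmax_right by lra. intro Ht.
    (* The two added products pair an image at 0 with an image at n and vanish by hypothesis. *)
    transitivity (f t * f' t + q t * q' t + s t * s' t
     - (f t * q' t + q t * f' t + (f t * s' t + s t * f' t)) + (q t * s' t + s t * q' t)); [ring|].
    rewrite Z1, Z2 by auto. ring.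
Qed.

(** * The basis functions as combinations of three shifted splines *)

Definition image3 (g : R -> R) (a b c : Z) (y : R) : R :=
  g (y + IZR a) - g (y + IZR b) - g (y + IZR c).

Lemma is_derive_image3 (g g' : R -> R) (n : R) (a b c : Z) (x : R) :
  (forall m : Z, is_derive g (n * x + IZR m) (g' (n * x + IZR m))) ->
  is_derive (fun x => image3 g a b c (n * x)) x (n * image3 g' a b c (n * x)).
Proof.
  intro H.
  assert (D : forall m, is_derive (fun x => g (n * x + IZR m)) x (n * g' (n * x + IZR m))).
  { intro m. apply (is_derive_comp g (fun x => n * x + IZR m) x _ n (H m)).
    auto_derive; auto; ring. }
  unfold image3. rewrite !Rmult_minus_distr_l.
  apply (is_derive_minus (fun x => g (n * x + IZR a) - g (n * x + IZR b))); [| apply D].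
  apply (is_derive_minus (fun x => g (n * x + IZR a))); apply D.
Qed.

(** Only the last differentiation of the case r = p needs n x off the integers: the formula for the
    preceding order holds everywhere, so it may be substituted under [Derive]. *)
Lemma Derive_n_image3 (p r : nat) (n : R) (a b c : Z) (x : R) :
  (r < p)%nat \/ (r = p /\ nonint (n * x)) ->
  Derive_n (fun x => image3 (cardN p) a b c (n * x)) r x
  = n ^ r * image3 (bdiff r (cardN (p - r))) a b c (n * x).
Proof.
  revert x. induction r as [|r IH]; intros x Hr.
  - simpl. rewrite Nat.sub_0_r. ring.
  - simpl Derive_n.
    rewrite (Derive_ext _ (fun x => n ^ r * image3 (bdiff r (cardN (p - r))) a b c (n * x)))
      by (intro; apply IH; lia).
    replace (p - r)%nat with (S (p - S r)) by lia.
    replace (n ^ S r) with (n ^ r * n) by (simpl; ring). rewrite Rmult_assoc.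
    apply is_derive_unique, is_derive_scal, is_derive_image3.
    intro m. apply is_derive_bdiff_cardN. destruct Hr as [Hr | [Hr Hx]].
    + left. lia.
    + right. now apply nonint_plus_IZR.
Qed.

Lemma Series_two_terms (a : nat -> R) :
  (forall k, (2 <= k)%nat -> a k = 0) -> Series a = a 0%nat + a 1%nat.
Proof.
  intro H.
  assert (E2 : ex_series (fun k => a (S (S k)))).
  { exists 0. apply is_series_ext with (fun _ => 0); [intro; symmetry; apply H; lia|].
    change (is_lim_seq (sum_n (fun _ => 0)) 0).
    apply (is_lim_seq_ext (fun _ => 0)); [| apply is_lim_seq_const].
    intro k. symmetry. rewrite sum_n_const. R_eq. ring. }
  assert (E1 : ex_series (fun k => a (S k))) by now apply (ex_series_incr_1 (fun k => a (S k))).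
  rewrite Series_incr_1 by now apply (ex_series_incr_1 a).
  rewrite Series_incr_1 by exact E1.
  (* Writing the zero tail as [0 * 0] lets linearity evaluate its sum. *)
  rewrite (Series_ext (fun k => a (S (S k))) (fun k => 0 * 0)) by (intro; rewrite H by lia; ring).
  rewrite (Series_scal_l 0 (fun _ => 0)). ring.
Qed.

Lemma zsum_01 (f : Z -> R) :
  (forall m, (m < 0 \/ 1 < m)%Z -> f m = 0) -> zsum f = f 0%Z + f 1%Z.
Proof.
  intro H. unfold zsum. rewrite !Series_two_terms by (intros; apply H; lia).
  rewrite !(H (- _)%Z) by lia. simpl. ring.
Qed.

Lemma Cc_far (p n : nat) (c x : R) :
  (INR p + 1) / 2 < Rabs (INR n * x - c) -> Cc p n c x = 0.
Proof.
  intro H. unfold Cc. unfold Rabs in H. destruct (Rcase_abs _).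
  - apply cardN_lt0. lra.
  - apply cardN_ge. lra.
Qed.

(** The spline has half-width h + 1/2, at most n + 1/2, and n x lies in (0, n); the centres i - 1/2
    + 2mn with m nonzero and -(i - 1/2) + 2mn with m outside {0, 1} are too far away. The survivors
    are the original and its mirror images at 0 and n. Since the degree 2h is even, the half-integer
    centres give integer shifts. *)
Lemma Nbar_image3 (h n i : nat) (x : R) :
  (h <= n)%nat -> (1 <= i <= n)%nat -> 0 < x < 1 ->
  let i' := Z.of_nat i in let h' := Z.of_nat h in
  Nbar (2 * h) n i x
  = image3 (cardN (2 * h)) (- (i' - h' - 1)) (i' + h') (- (2 * Z.of_nat n - i' - h')) (INR n * x).
Proof.
  intros Hh Hi Hx i' h'.
  assert (Hh' : INR h <= INR n) by (apply le_INR; lia).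
  assert (Hi1 : 1 <= INR i) by (apply (le_INR 1); lia).
  assert (Hi2 : INR i <= INR n) by (apply le_INR; lia).
  assert (Hy : 0 < INR n * x < INR n) by nra.
  assert (Ep : INR (2 * h) = 2 * INR h) by (rewrite mult_INR; simpl; ring).
  assert (F1 : forall m : Z, (m < 0 \/ 0 < m)%Z -> Cc (2 * h) n (INR i - / 2 + 2 * IZR m * INR n) x = 0).
  { intros m Hm. apply Cc_far. rewrite Ep. destruct Hm as [Hm | Hm].
    - assert (Hm' : IZR m <= -1) by (apply IZR_le; lia).
      eapply Rlt_le_trans; [| apply Rle_abs]. nra.
    - assert (Hm' : 1 <= IZR m) by (apply IZR_le; lia).
      rewrite Rabs_minus_sym. eapply Rlt_le_trans; [| apply Rle_abs]. nra. }
  assert (F2 : forall m : Z, (m < 0 \/ 1 < m)%Z -> Cc (2 * h) n (- (INR i - / 2) + 2 * IZR m * INR n) x = 0).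
  { intros m Hm. apply Cc_far. rewrite Ep. destruct Hm as [Hm | Hm].
    - assert (Hm' : IZR m <= -1) by (apply IZR_le; lia).
      eapply Rlt_le_trans; [| apply Rle_abs]. nra.
    - assert (Hm' : 2 <= IZR m) by (apply IZR_le; lia).
      rewrite Rabs_minus_sym. eapply Rlt_le_trans; [| apply Rle_abs]. nra. }
  unfold Nbar. rewrite zsum_01 by (intros m Hm; rewrite F1, F2 by lia; ring).
  rewrite (F1 1%Z) by lia.
  unfold Cc, image3, i', h'. rewrite Ep.
  rewrite !opp_IZR, !minus_IZR, !plus_IZR, mult_IZR, <- !INR_IZR_INZ.
  replace (INR n * x - (INR i - / 2 + 2 * 0 * INR n) + (2 * INR h + 1) / 2)
    with (INR n * x + - (INR i - INR h - 1)) by field.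
  replace (INR n * x - (- (INR i - / 2) + 2 * 0 * INR n) + (2 * INR h + 1) / 2)
    with (INR n * x + (INR i + INR h)) by field.
  replace (INR n * x - (- (INR i - / 2) + 2 * 1 * INR n) + (2 * INR h + 1) / 2)
    with (INR n * x + - (2 * INR n - INR i - INR h)) by field.
  ring.
Qed.

(** In the variable y = n x the unfolding leaves three correlations: original with original gives
    the Toeplitz entry, original with the images at 0 and n the two Hankel terms. *)
Lemma RInt_image3 (h n r i j : nat) :
  (3 * h <= n)%nat -> (r <= 2 * h)%nat -> (1 <= i <= n)%nat -> (1 <= j <= n)%nat ->
  let p := (2 * h)%nat in let h' := Z.of_nat h in let n' := Z.of_nat n in
  let G i := image3 (bdiff r (cardN (p - r)))
    (- (Z.of_nat i - h' - 1)) (Z.of_nat i + h') (- (2 * n' - Z.of_nat i - h')) in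
  RInt (fun y => G i y * G j y) 0 (IZR n')
  = toeplitzT (alpha p r) i j - hankelH1 (alpha p r) n i j.
Proof.
  intros Hn Hr Hi Hj p h' n' G.
  set (f := bdiff r (cardN (p - r))) in *.
  assert (Pf : forall m, pwc (fun t => f (t + IZR m))) by (intro; apply pwc_shift, pwc_bdiff, pwc_cardN).
  assert (Ep : INR p = 2 * IZR h') by (unfold p, h'; rewrite mult_INR, <- INR_IZR_INZ; simpl; ring).
  assert (Hf0 : forall t, t < 0 -> f t = 0) by apply bdiff_lt0, cardN_lt0.
  assert (Hf1 : forall t, INR p + 1 <= t -> f t = 0).
  { intros t Ht. apply (bdiff_ge r _ (INR (p - r) + 1)); [apply cardN_ge|].
    rewrite minus_INR by (unfold p; lia). lra. }
  assert (Ef : forall t, nonint t -> f (INR p + 1 - t) = (-1) ^ r * f t).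
  { intros t Ht. unfold f. rewrite <- (bdiff_reflect r _ (INR (p - r) + 1)) by (auto using cardN_reflect).
    f_equal. rewrite minus_INR by (unfold p; lia). ring. }
  (* Reflection at 0, and likewise at n in [S'], becomes reflection of the argument of [f] about (p
     + 1) / 2. *)
  assert (Q : forall k t, nonint t ->
    f (0 - t + IZR (Z.of_nat k + h')) = (-1) ^ r * f (t + IZR (- (Z.of_nat k - h' - 1)))).
  { intros k t Ht. rewrite <- Ef by now apply nonint_plus_IZR. f_equal.
    rewrite Ep, opp_IZR, !minus_IZR, plus_IZR. ring. }
  assert (S' : forall k t, nonint t ->
    f (IZR (2 * n') - t + IZR (- (2 * n' - Z.of_nat k - h')))
    = (-1) ^ r * f (t + IZR (- (Z.of_nat k - h' - 1)))).
  { intros k t Ht. rewrite <- Ef by now apply nonint_plus_IZR. f_equal.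
    rewrite Ep, !opp_IZR, !minus_IZR. ring. }
  (* The image at 0 lives on t < h + 1 - k, at most h, while the image at n starts at 2n - l - h, at
     least n - h and so at least 2h. *)
  assert (QS : forall k l t, (1 <= k)%nat -> (l <= n)%nat ->
    f (t + IZR (Z.of_nat k + h')) * f (t + IZR (- (2 * n' - Z.of_nat l - h'))) = 0).
  { intros k l t Hk Hl.
    assert (K : 1 <= IZR (Z.of_nat k)) by (apply IZR_le; lia).
    assert (L : IZR (Z.of_nat l) <= IZR n') by (apply IZR_le; lia).
    assert (M : 3 * IZR h' <= IZR n') by (rewrite <- mult_IZR; apply IZR_le; lia).
    assert (H0 : 0 <= IZR h') by (apply IZR_le; lia).
    destruct (Rle_lt_dec (INR p + 1) (t + IZR (Z.of_nat k + h'))) as [A | A].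
    - rewrite Hf1 by exact A. ring.
    - rewrite (Hf0 (t + IZR (- (2 * n' - Z.of_nat l - h')))); [ring|].
      rewrite plus_IZR in A. rewrite opp_IZR, !minus_IZR, mult_IZR. lra. }
  unfold G, image3.
  rewrite (RInt_unfold_reflections ((-1) ^ r) n'
    (fun y => f (y + IZR (- (Z.of_nat i - h' - 1)))) (fun y => f (y + IZR (Z.of_nat i + h')))
    (fun y => f (y + IZR (- (2 * n' - Z.of_nat i - h'))))
    (fun y => f (y + IZR (- (Z.of_nat j - h' - 1)))) (fun y => f (y + IZR (Z.of_nat j + h')))
    (fun y => f (y + IZR (- (2 * n' - Z.of_nat j - h'))))); auto; try (unfold n'; lia).
  - unfold toeplitzT, hankelH1.
    assert (I1 : RInt (fun t => f (t + IZR (- (Z.of_nat i - h' - 1))) * f (t + IZR (- (Z.of_nat j - h' - 1))))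
        (IZR (- n')) (IZR (2 * n')) = alpha p r (if (j <=? i)%nat then (i - j)%nat else (j - i)%nat)).
    (* The factor whose support starts further right has to come first in the correlation. *)
    { destruct (Nat.leb_spec j i) as [K | K].
      - unfold f. rewrite RInt_correlation by lia. f_equal. lia.
      - rewrite (RInt_ext _ (fun t => f (t + IZR (- (Z.of_nat j - h' - 1))) * f (t + IZR (- (Z.of_nat i - h' - 1)))))
          by (intros; apply Rmult_comm).
        unfold f. rewrite RInt_correlation by lia. f_equal. lia. }
    assert (I2 : RInt (fun t => f (t + IZR (- (Z.of_nat i - h' - 1))) * f (t + IZR (Z.of_nat j + h')))
        (IZR (- n')) (IZR n') = alpha p r (i + j - 1)).
    { replace (Z.of_nat j + h')%Z with (- (- (Z.of_nat j + h')))%Z by lia.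
      unfold f. rewrite RInt_correlation by lia. f_equal. lia. }
    assert (I3 : RInt (fun t => f (t + IZR (- (Z.of_nat i - h' - 1))) * f (t + IZR (- (2 * n' - Z.of_nat j - h'))))
        (IZR 0) (IZR (2 * n')) = alpha p r (2 * n + 1 - i - j)).
    { rewrite (RInt_ext _ (fun t => f (t + IZR (- (2 * n' - Z.of_nat j - h'))) * f (t + IZR (- (Z.of_nat i - h' - 1)))))
          by (intros; apply Rmult_comm).
      unfold f. rewrite RInt_correlation by lia. f_equal. lia. }
    R_eq. rewrite I1, I2, I3. ring.
  - rewrite <- Rpow_mult_distr. replace (-1 * -1) with 1 by ring. apply pow1.
  - intros t _. apply QS; lia.
  - intros t _. rewrite Rmult_comm. apply QS; lia.
Qed.

(** * Rescaling to the unit interval *)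

Theorem mainTheorem13 (p n r : nat) :
  (1 <= p)%nat -> Nat.Even p -> (p + p / 2 <= n)%nat -> (r <= p)%nat ->
  forall i j : nat, (1 <= i <= n)%nat -> (1 <= j <= n)%nat ->
  Xbar p r n i j =
    powerRZ (INR n) (2 * Z.of_nat r - 1)%Z
    * (toeplitzT (alpha p r) i j - hankelH1 (alpha p r) n i j).
Proof.
  intros Hp [h ->] Hn Hr i j Hi Hj.
  rewrite Nat.mul_comm, Nat.div_mul, Nat.mul_comm in Hn by lia.
  assert (N : 0 < INR n) by (apply lt_0_INR; lia).
  pose proof (RInt_image3 h n r i j ltac:(lia) Hr Hi Hj) as HG. cbv zeta in HG.
  set (f := bdiff r (cardN (2 * h - r))) in *.
  set (G := fun k : nat => image3 f (- (Z.of_nat k - Z.of_nat h - 1)) (Z.of_nat k + Z.of_nat h)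
    (- (2 * Z.of_nat n - Z.of_nat k - Z.of_nat h))) in *.
  change (RInt (fun y => G i y * G j y) 0 (IZR (Z.of_nat n)) = toeplitzT (alpha (2 * h) r) i j - hankelH1 (alpha (2 * h) r) n i j) in HG.
  assert (D : forall k x, (1 <= k <= n)%nat -> 0 < x < 1 -> nonint (INR n * x) ->
    Derive_n (Nbar (2 * h) n k) r x = INR n ^ r * G k (INR n * x)).
  { intros k x Hk Hx Hnx. unfold G, f. rewrite <- Derive_n_image3 by (destruct (Nat.eq_dec r (2 * h)); [right; auto | left; lia]).
    apply Derive_n_ext_loc.
    (* The representation by three images holds on the whole neighbourhood (0, 1) of x, so it passes
       to derivatives. *)
    apply filter_imp with (fun y => 0 < y < 1); [| apply (locally_interval _ x 0 1); simpl; tauto].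
    intros y Hy. apply Nbar_image3; auto; lia. }
  assert (PG : forall k, pwc (G k)).
  { intro k. unfold G, image3. repeat apply pwc_minus; apply pwc_shift, pwc_bdiff, pwc_cardN. }
  set (D2 := fun x => Derive_n (Nbar (2 * h) n i) r x * Derive_n (Nbar (2 * h) n j) r x).
  (* Each of the two derivatives contributes n^r by the chain rule; the values of [D2] at the
     breakpoints do not affect the integral. *)
  assert (I : is_RInt (fun y => D2 (y / INR n)) 0 (IZR (Z.of_nat n))
    (INR n ^ (2 * r) * RInt (fun y => G i y * G j y) 0 (IZR (Z.of_nat n)))).
  { pose proof (pwc_mult _ _ (PG i) (PG j)) as PP.
    pose proof (RInt_scal (V := R_CompleteNormedModule) (fun y => G i y * G j y) 0 (IZR (Z.of_nat n)) (INR n ^ (2 * r))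
      (pwc_ex_RInt _ 0 _ PP)) as E.
    unfold scal in E; simpl in E; unfold mult in E; simpl in E.
    simpl. rewrite <- E. apply (RInt_ext_nonint _ _ 0); [now apply pwc_scal|].
    intros t Ht. rewrite <- INR_IZR_INZ, Rmin_left, Rmax_right by lra. intros [H0 H1].
    assert (Et : INR n * (t / INR n) = t) by (field; lra).
    assert (Hx : 0 < t / INR n < 1).
    { split; [now apply Rdiv_lt_0_compat|]. apply (Rmult_lt_reg_l (INR n)); auto. rewrite Et. lra. }
    unfold D2. rewrite !D by (auto; rewrite ?Et; auto). rewrite Et.
    rewrite Nat.add_0_r, pow_add. ring. }
  unfold Xbar. fold D2. apply is_RInt_unique. rewrite HG in I. clear HG.
  set (T := toeplitzT (alpha (2 * h) r) i j - hankelH1 (alpha (2 * h) r) n i j) in *.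
  assert (EP : powerRZ (INR n) (2 * Z.of_nat r - 1) = / INR n * INR n ^ (2 * r)).
  { replace (2 * Z.of_nat r - 1)%Z with (Z.of_nat (2 * r) + -1)%Z by lia.
    rewrite powerRZ_add, <- pow_powerRZ by lra. simpl. field. lra. }
  (* The remaining factor 1/n is the Jacobian of y = n x. *)
  replace (powerRZ (INR n) (2 * Z.of_nat r - 1) * T) with (scal (/ INR n) (INR n ^ (2 * r) * T)).
  - apply is_RInt_ext with (fun x => scal (/ INR n) (scal (INR n) (D2 ((INR n * x + 0) / INR n)))).
    + intros x _. unfold scal; simpl; unfold mult; simpl. R_eq.
      replace ((INR n * x + 0) / INR n) with x by (field; lra). R_eq. field. lra.
    + apply (is_RInt_scal (V := R_NormedModule) (fun x => scal (INR n) (D2 ((INR n * x + 0) / INR n)))).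
      apply (is_RInt_comp_lin (fun y => D2 (y / INR n))).
      rewrite Rmult_0_r, Rmult_1_r, !Rplus_0_r. rewrite <- INR_IZR_INZ in I. exact I.
  - rewrite EP. unfold scal; simpl; unfold mult; simpl. R_eq. ring.
Qed.
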